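(* If $q\in Q$ is a local optimal solution of the problem $\min_{q\in Q}j(q)$, where $j(q)=\tfrac12\|S(q)-u_d\|^2_{L^2(\Omega)}+\mathcal{R}(q)$, then the first order necessary optimality condition holds: $$j'(q)(h)=0\qquad\text{for all }h\in Q,$$ where $j'(q)(h)$ denotes the Gâteaux (directional) derivative of $j$ at $q$ in the direction $h$.
   Context: $\Omega\subset\mathbb{R}^n$, $n\ge1$, is a bounded domain with $C^\infty$ boundary; $Q=\{(s,\delta)\in\mathbb{R}^2: 0<s<1,\ 0<\delta<\infty\}$. $H^s_\Omega(\mathbb{R}^n)=\{v\in H^s(\mathbb{R}^n): v=0\text{ on }\mathbb{R}^n\setminus\Omega\}$ with the seminorm of $H^s(\mathbb{R}^n)$ as norm. For $q=(s,\delta)\in Q$, $$a(u,v;q)=\iint_{\{|x-y|\le\delta\}}\frac{(u(x)-u(y))(v(x)-v(y))}{|x-y|^{n+2s}}\,dy\,dx .$$ With $\varepsilon>0$ arbitrarily small, $f\in H^{1/2-\varepsilon}(\Omega)$ and $u_d\in H^{1/2-\varepsilon}(\Omega)$ are given, and $S(q)\in H^s_\Omega(\mathbb{R}^n)$ is the unique solution of $a(S(q),v;q)=(f,v)_{L^2(\Omega)}$ for all $v\in H^s_\Omega(\mathbb{R}^n)$. The regularization $\mathcal{R}:Q\to[0,\infty)$ belongs to $C^2(Q)$ and has the form $\mathcal{R}(s,\delta)=\phi_1(s)+\phi_2(\delta)$ with nonnegative convex functions $\phi_1,\phi_2$ satisfying $\lim_{s\to0}\phi_1(s)=\lim_{s\to1}\phi_1(s)=+\infty$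 and $\lim_{\delta\to0}\phi_2(\delta)=\lim_{\delta\to\infty}\phi_2(\delta)=+\infty$. The map $S:Q\to L^2(\Omega)$ is differentiable, so that $j$ is Gâteaux differentiable. *)

(* Defs.v *)
From HB Require Import structures.
From mathcomp Require Import all_boot all_order all_algebra.
From mathcomp Require Import all_classical all_reals all_analysis.

Set Implicit Arguments.
Unset Strict Implicit.
Unset Printing Implicit Defensive.
Import Order.TTheory GRing.Theory Num.Theory.
Import numFieldNormedType.Exports.

Local Open Scope classical_set_scope.
Local Open Scope ring_scope.

(** * Lebesgue measure on ['rV[R]_n] *)

Definition rV_display : measure_display. Proof. by constructor. Qed.

Section measurable_rV.
Context {R : realType} {n : nat}.

Definition rV_coord (i : 'I_n) (v : 'rV[R]_n) : measurableTypeR R := v ord0 i.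

Let rV_set0 : g_sigma_preimage rV_coord set0.
Proof. exact: sigma_algebra0. Qed.

Let rV_setC A : g_sigma_preimage rV_coord A -> g_sigma_preimage rV_coord (~` A).
Proof. exact: sigma_algebraC. Qed.

Let rV_bigcup (F : (set 'rV[R]_n)^nat) :
  (forall i, g_sigma_preimage rV_coord (F i)) ->
  g_sigma_preimage rV_coord (\bigcup_i (F i)).
Proof. exact: sigma_algebra_bigcup. Qed.

(* The sigma-algebra generated by the coordinates, as the library does for
   tuples; on ['rV[R]_n] it is the Borel sigma-algebra. *)
HB.instance Definition _ := @isMeasurable.Build rV_display
  'rV[R]_n (g_sigma_preimage rV_coord) rV_set0 rV_setC rV_bigcup.

Lemma measurable_rV_coord (i : 'I_n) : measurable_fun setT (rV_coord i).
Proof.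
move=> _ Y mY; rewrite setTI; apply: sub_sigma_algebra => /=.
rewrite -bigcup_seq/=; exists i => /=; first by rewrite mem_index_enum.
by exists Y => //; rewrite setTI.
Qed.

Lemma measurable_fun_rV d (T : measurableType d) (f : T -> 'rV[R]_n) :
  (forall i, measurable_fun setT (rV_coord i \o f)) -> measurable_fun setT f.
Proof.
move=> mf; have : g_sigma_preimage (fun i => rV_coord i \o f) `<=` measurable.
  apply: smallest_sub; first exact: sigma_algebra_measurable.
  by rewrite -bigcup_seq => A/= [i _] [B mB <-]; exact: mf.
rewrite g_sigma_preimage_comp => h _ A mA; apply: h.
by exists A.
Qed.

End measurable_rV.


Section lebesgue_rV.
Context {R : realType}.

Definition cons_rV (n : nat) (p : measurableTypeR R * 'rV[R]_n) : 'rV[R]_n.+1 :=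
  row_mx (p.1 : R)%:M p.2.

Lemma measurable_cons_rV (n : nat) : measurable_fun setT (@cons_rV n).
Proof.
apply: measurable_fun_rV => i; rewrite -(@splitK 1 n i).
case: (fintype.split _) => j /=.
- rewrite (_ : _ \o _ = fst) //; apply/funext => -[x v] /=.
  by rewrite /rV_coord/= /cons_rV (@row_mxEl _ 1 1 n)/= (ord1 j) mxE.
- rewrite (_ : _ \o _ = rV_coord j \o snd); last first.
    by apply/funext => -[x v] /=; rewrite /rV_coord/= /cons_rV (@row_mxEr _ 1 1 n).
  exact: measurableT_comp (measurable_rV_coord j) _.
Qed.

Definition cons_measure (n : nat) (mu : {measure set 'rV[R]_n -> \bar R}) :=
  pushforward (@lebesgue_measure R \x^ mu)%E (@cons_rV n).

Section cons_measure.
Context (n : nat) (mu : {measure set 'rV[R]_n -> \bar R}).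

Let mcons : measurable_fun setT (@cons_rV n) := @measurable_cons_rV n.

Let cons_measure0 : cons_measure mu set0 = 0%E.
Proof. by rewrite /cons_measure /pushforward preimage_set0 measure0. Qed.

Let cons_measure_ge0 A : (0 <= cons_measure mu A)%E.
Proof. exact: measure_ge0. Qed.

Let cons_measure_sigma_additive : semi_sigma_additive (cons_measure mu).
Proof. by rewrite /cons_measure; exact: measure_semi_sigma_additive. Qed.

HB.instance Definition _ := isMeasure.Build _ _ _ (cons_measure mu)
  cons_measure0 cons_measure_ge0 cons_measure_sigma_additive.

End cons_measure.

(* Lebesgue measure on R^(n+1) is the image of the product of the Lebesgue
   measures on R and R^n; on R^0 it is the unit mass at the only point. *)
Fixpoint lebesgue_rV (n : nat) : {measure set 'rV[R]_n -> \bar R} :=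
  if n is m.+1 then cons_measure (lebesgue_rV m) else dirac (0 : 'rV[R]_0).

Lemma lebesgue_rV_box (n : nat) (A : 'I_n -> set (measurableTypeR R)) :
  (forall i, measurable (A i)) ->
  lebesgue_rV n [set v | forall i, A i (v ord0 i)] =
  (\prod_(i < n) @lebesgue_measure R (A i))%E.
Proof.
elim: n => [|n IHn] in A * => mA.
  rewrite big_ord0 /= diracE mem_set//= => -[].
  by [].
rewrite big_ord_recl /= /cons_measure /pushforward.
rewrite (_ : _ @^-1` _ =
    A ord0 `*` [set v : 'rV[R]_n | forall i, A (lift ord0 i) (v ord0 i)]).
  rewrite product_measure2E //.
    by congr (_ * _)%E; apply: IHn => i; exact: mA.
  rewrite (_ : mkset _ =
    \bigcap_(i : 'I_n) (rV_coord i @^-1` A (lift ord0 i))).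
    apply: fin_bigcap_measurable => // i _; rewrite -[X in measurable X]setTI.
    exact: measurable_rV_coord.
  by apply/seteqP; split => v /= h i; [move=> _; exact: h|exact: (h i I)].
have E0 x (v : 'rV[R]_n) : cons_rV (x, v) ord0 ord0 = x.
  rewrite /cons_rV /= (_ : ord0 = lshift n (ord0 : 'I_1)); last exact/val_inj.
  by rewrite (@row_mxEl _ 1 1 n) mxE.
have EL x (v : 'rV[R]_n) i : cons_rV (x, v) ord0 (lift ord0 i) = v ord0 i.
  rewrite /cons_rV /= (_ : lift ord0 i = rshift 1 i); last exact/val_inj.
  by rewrite (@row_mxEr _ 1 1 n).
apply/seteqP; split => [[x v] /= h|[x v] /= [h0 h] i].
  split; first by have := h ord0; rewrite E0.
  by move=> i; have := h (lift ord0 i); rewrite EL.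
by case: (unliftP ord0 i) => [j|] ->; rewrite ?E0 ?EL.
Qed.

End lebesgue_rV.

(** * Smoothness *)

(* For D open. In finite dimension, asking for all the directional derivatives
   rather than for the partial ones gives the same class. *)
Fixpoint Ck_on (R : realType) (V : normedModType R) (k : nat) (D : set V)
    (f : V -> R) : Prop :=
  {in D, continuous f} /\
  (if k is m.+1 then
     forall v, {in D, forall x, derivable f x v} /\ Ck_on m D ('D_v f)
   else True).

Section nonlocal.
Context {R : realType}.

(* The library norm on ['rV[R]_n] is the sup norm. *)
Definition enorm (n : nat) (x : 'rV[R]_n) : R :=
  Num.sqrt (\sum_(i < n) x ord0 i ^+ 2).

(* Up to permuting and reversing the coordinate axes, Omega lies near each of
   its boundary points on one side of the graph of a smooth function gamma of
   the other n - 1 coordinates. *)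
Definition smooth_boundary (n : nat) (Omega : set 'rV[R]_n) : Prop :=
  forall x0, (closure Omega `\` Omega) x0 ->
  exists r (i : 'I_n) (b : bool) (gamma : 'rV[R]_(n.-1) -> R),
    [/\ 0 < r, forall k, Ck_on k setT gamma &
        forall x, enorm (x - x0) < r ->
          Omega x <-> gamma (col' i x) < (-1) ^+ b * x ord0 i].

Definition smooth_bounded_domain (n : nat) (Omega : set 'rV[R]_n) : Prop :=
  [/\ open Omega, Omega !=set0, connected Omega, bounded_set Omega &
      smooth_boundary Omega].

(** * Function spaces *)

(* Elements of the spaces below are represented by functions that are defined
   on the whole of R^n; only their values on D matter, and almost everywhere. *)

Section spaces.
Context {n : nat}.
Local Notation mu := (@lebesgue_rV R n).
Implicit Types (D : set 'rV[R]_n) (v : 'rV[R]_n -> R) (s : R).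

Definition in_L2 D v : Prop := v \_ D \in Lfun mu 2%:E.

Definition L2norm D v : R := fine ('N[mu]_2%:E[EFin \o v \_ D]).

(* The square of the seminorm of H^s(D), for 0 < s < 1. *)
Definition gagliardo D s v : \bar R :=
  (\int[mu]_(x in D) \int[mu]_(y in D)
     ((v x - v y) ^+ 2 / enorm (x - y) `^ (n%:R + 2 * s))%:E)%E.

Definition in_Hs D s v : Prop := in_L2 D v /\ (gagliardo D s v < +oo)%E.

Definition in_HsOmega (Omega : set 'rV[R]_n) s v : Prop :=
  in_Hs setT s v /\ {ae mu, forall x, ~ Omega x -> v x = 0}.

(** * The state equation *)

Definition nonlocal_form (u v : 'rV[R]_n -> R) (q : R * R) : R :=
  \int[mu]_x \int[mu]_(y in [set y | enorm (x - y) <= q.2])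
    ((u x - u y) * (v x - v y) / enorm (x - y) `^ (n%:R + 2 * q.1)).

Definition weak_solution (Omega : set 'rV[R]_n) (f : 'rV[R]_n -> R)
    (q : R * R) (u : 'rV[R]_n -> R) : Prop :=
  in_HsOmega Omega q.1 u /\
  forall v, in_HsOmega Omega q.1 v ->
    nonlocal_form u v q = \int[mu]_(x in Omega) (f x * v x).

Definition unique_weak_solution (Omega : set 'rV[R]_n) (f : 'rV[R]_n -> R)
    (q : R * R) (u : 'rV[R]_n -> R) : Prop :=
  weak_solution Omega f q u /\
  forall w, weak_solution Omega f q w -> {ae mu, forall x, w x = u x}.

(* Frechet differentiability at q of a map from an open set of R^2 to L^2(D);
   linearity is an equality in L^2(D), and boundedness is automatic since the
   source is finite-dimensional. *)
Definition L2_differentiable D (S : R * R -> 'rV[R]_n -> R) (q : R * R) : Prop :=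
  exists dS : R * R -> 'rV[R]_n -> R,
    [/\ forall h, in_L2 D (dS h),
        forall (c : R) h k,
          {ae mu, forall x, D x -> dS (c *: h + k) x = c * dS h x + dS k x} &
        `|h|^-1 * L2norm D (S (q + h) \- S q \- dS h) @[h --> (0 : R * R)^'] --> 0].

End spaces.

(** * The optimization problem *)

Definition Q : set (R * R) := [set q | [/\ 0 < q.1, q.1 < 1 & 0 < q.2]].

Definition admissible_regularization (Reg : R * R -> R) : Prop :=
  [/\ {in Q, forall q, 0 <= Reg q}, Ck_on 2 Q Reg &
  exists phi1 phi2 : R -> R,
    [/\ {in Q, forall q, Reg q = phi1 q.1 + phi2 q.2},
        (forall s, 0 < s < 1 -> 0 <= phi1 s) /\
        (forall d, 0 < d -> 0 <= phi2 d),
        @convex_function R R^o `]0, 1[ phi1 /\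
        @convex_function R R^o `]0, +oo[ phi2,
        phi1 s @[s --> 0^'+] --> +oo /\ phi1 s @[s --> 1^'-] --> +oo &
        phi2 d @[d --> 0^'+] --> +oo /\ phi2 d @[d --> +oo] --> +oo]].

Definition cost (n : nat) (Omega : set 'rV[R]_n) (u_d : 'rV[R]_n -> R)
    (S : R * R -> 'rV[R]_n -> R) (Reg : R * R -> R) (q : R * R) : R :=
  2^-1 * L2norm Omega (S q \- u_d) ^+ 2 + Reg q.

Definition local_minimizer (D : set (R * R)) (j : R * R -> R) (q : R * R) :=
  D q /\ \forall p \near q, D p -> j q <= j p.

End nonlocal.

(* Main.v *)
Require Import Defs.
From mathcomp Require Import all_boot all_order all_algebra.
From mathcomp Require Import all_classical all_reals all_analysis.
From mathcomp Require Import measurable_realfun ring lra.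
Import Order.TTheory GRing.Theory Num.Theory.
Import numFieldNormedType.Exports.
Local Open Scope classical_set_scope.
Local Open Scope ring_scope.

(** The set Q is open, so q is an interior local minimizer of the cost j, and
    it suffices to differentiate j at q along an arbitrary line t |-> q + t h:
    the difference quotients are nonnegative for t > 0 and nonpositive for
    t < 0, hence their common limit vanishes ([derive_local_min0]).

    The regularization is C^2, so the work is in the tracking term
    |S(q + t h) - u_d|^2 / 2.  Differentiability of S in L^2(Omega) says that
    S(q + t h) - u_d = A + t G + r(t) with A = S(q) - u_d and |r(t)| = o(t)
    ([L2_differentiable_line]).  Along the affine path the squared norm is the
    polynomial |A|^2 + 2 t <A, G> + t^2 |G|^2, and the reverse triangle
    inequality bounds the error made by dropping r(t) by |r(t)| times a bounded
    factor, which is again o(t).  So the squared norm has derivative 2 <A, G>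
    at t = 0 ([cvg_sqr_norm2_quotient]).

    These computations need S(p) to be square integrable over Omega, whereas
    the state equation provides square integrability over the whole space;
    restricting is legitimate because open sets belong to the sigma-algebra
    generated by the coordinates ([open_measurable_rV]). *)

(** * Measurability of open sets *)

Section open_rV.
Context {R : realType} {n : nat}.

Let rat_box (c : 'rV[rat]_n * 'rV[rat]_n) : set 'rV[R]_n :=
  [set v | forall i, ratr (c.1 ord0 i) < v ord0 i < ratr (c.2 ord0 i)].

Let measurable_rat_box c : measurable (rat_box c).
Proof.
rewrite (_ : rat_box c = \bigcap_(i : 'I_n)
    (rV_coord i @^-1` `](ratr (c.1 ord0 i)), (ratr (c.2 ord0 i))[%classic)).
  apply: fin_bigcap_measurable => // i _; rewrite -[X in measurable X]setTI.
  exact: measurable_rV_coord.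
apply/seteqP; split=> [v vc i _|v vc i]; first by rewrite /= in_itv/=; exact: vc.
by have := vc i I; rewrite /= in_itv.
Qed.

(** Every open set is the union of the countably many rational boxes that it
    contains, and a box is a finite intersection of coordinate preimages. *)
Lemma open_measurable_rV (D : set 'rV[R]_n) : open D -> measurable D.
Proof.
move=> oD.
pose box c : set 'rV[R]_n := if `[< rat_box c `<=` D >] then rat_box c else set0.
rewrite (_ : D = \bigcup_c box c).
  apply: countable_bigcupT_measurable => [//|c]; rewrite /box.
  by case: asboolP => // _; exact: measurable0.
apply/seteqP; split=> [x Dx|x [c _]]; last first.
  by rewrite /box; case: asboolP => // cD /cD.
have /nbhs_ballP[e /= e0 xeD] := open_nbhs_nbhs (conj oD Dx).
have lb i : exists a : rat, x ord0 i - e < ratr a < x ord0 i.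
  have /rat_in_itvoo[r] : x ord0 i - e < x ord0 i by rewrite ltrBlDr ltrDl.
  by rewrite in_itv => ?; exists r.
have ub i : exists b : rat, x ord0 i < ratr b < x ord0 i + e.
  have /rat_in_itvoo[r] : x ord0 i < x ord0 i + e by rewrite ltrDl.
  by rewrite in_itv => ?; exists r.
have [a aP] := choice lb; have [b bP] := choice ub.
exists (\row_i a i, \row_i b i) => //; rewrite /box; case: asboolP => [_ i|[]].
  by rewrite !mxE/=; have /andP[_ ->] := aP i; have /andP[-> _] := bP i.
rewrite /= => v vab; apply: xeD; split=> // j i; rewrite ord1.
have := vab i; rewrite !mxE/= => /andP[av vb].
have /andP[a1 a2] := aP i; have /andP[b1 b2] := bP i.
by rewrite /ball/= ltr_norml; apply/andP; split; lra.
Qed.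

End open_rV.

(** * Lines in a normed space *)

Section lines.
Context {R : realType} (V : normedModType R).
Implicit Types h q : V.

Lemma cvg_scale0 h : t *: h @[t --> (0 : R)] --> (0 : V).
Proof.
rewrite -[X in _ --> X](scale0r h).
have id0 : t @[t --> (0 : R)] --> (0 : R) by exact: cvg_id.
exact: cvgZr_tmp id0.
Qed.

Lemma cvg_line0 h q : t *: h + q @[t --> (0 : R)] --> q.
Proof.
rewrite -[X in _ --> X]add0r.
by apply: cvgD; [exact: cvg_scale0|exact: cvg_cst].
Qed.

(** This turns a remainder that is small in the punctured sense of Frechet
    differentiability into one that is small along a line. *)
Lemma cvg_scale_dnbhs0 h : h != 0 ->
  t *: h @[t --> (0 : R)^'] --> 0^'.
Proof.
move=> h0 A A0.
have Ath : \forall t \near (0 : R), t *: h != 0 -> A (t *: h)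
  by exact: cvg_scale0 A0.
change (\forall t \near (0 : R)^', A (t *: h)).
near=> t.
suff : t *: h != 0 -> A (t *: h).
  apply; rewrite scaler_eq0 negb_or h0 andbT.
  by near: t; exact: nbhs_dnbhs_neq.
near: t; exact: cvg_within Ath.
Unshelve. all: by end_near. Qed.

(** Fermat's rule on an interior minimizer: the right and left limits of the
    difference quotient have opposite weak signs, and both are the derivative. *)
Lemma derive_local_min0 (j : V -> R) q h :
  derivable j q h -> (\forall p \near q, j q <= j p) -> 'D_h j q = 0.
Proof.
move=> dj jmin; apply/eqP; rewrite eq_le.
have near_min : \forall t \near (0 : R), j q <= j (t *: h + q).
  exact: cvg_line0 jmin.
have Dr := cvg_dnbhs_at_right dj.
have Dl := cvg_dnbhs_at_left dj.
apply/andP; split.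
  apply: (cvgr_to_le Dl).
  near=> t; apply: mulr_le0_ge0; first by rewrite invr_le0; exact: ltW.
  rewrite subr_ge0 /=; near: t; exact: cvg_within near_min.
apply: (cvgr_to_ge Dr).
near=> t; apply: mulr_ge0; first by rewrite invr_ge0; exact: ltW.
rewrite subr_ge0 /=; near: t; exact: cvg_within near_min.
Unshelve. all: by end_near. Qed.

End lines.

(** * The L2 norm *)

Section L2_space.
Context {d : measure_display} {T : measurableType d} {R : realType}.
Context (mu : {measure set T -> \bar R}).
Implicit Types F G : T -> R.

Local Notation norm2 F := (fine ('N[mu]_2%:E[EFin \o F])) (only parsing).

Lemma Lfun2D F G : F \in Lfun mu 2%:E -> G \in Lfun mu 2%:E ->
  (F \+ G) \in Lfun mu 2%:E.
Proof. by move=> LF LG; have [_] := Lfun_addr_closed mu (lee1n 2); apply. Qed.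

Lemma Lfun2Z (c : R) F : F \in Lfun mu 2%:E -> (c \*: F) \in Lfun mu 2%:E.
Proof.
move=> LF; have -> : c \*: F = c \o* F by apply/funext => x /=; rewrite mulrC.
by apply: Lfun_scale => //; lra.
Qed.

Lemma Lfun2B F G : F \in Lfun mu 2%:E -> G \in Lfun mu 2%:E ->
  (F \- G) \in Lfun mu 2%:E.
Proof.
move=> LF LG; apply: Lfun2D => //.
have -> : (fun x => - G x) = (-1) \*: G.
  by apply/funext => x /=; rewrite -[RHS]/(-1 * G x) mulN1r.
exact: Lfun2Z.
Qed.

Lemma Lfun2_measurable F : F \in Lfun mu 2%:E -> measurable_fun setT F.
Proof. by move=> /andP[/set_mem]. Qed.

Lemma Lfun2_restrict (D : set T) (v : T -> R) : measurable D ->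
  v \in Lfun mu 2%:E -> v \_ D \in Lfun mu 2%:E.
Proof.
move=> mD Lv.
have mv := Lfun2_measurable _ Lv.
have mvD : measurable_fun setT (v \_ D).
  by apply/(measurable_restrictT _ mD); exact: measurable_funTS.
have /andP[_ /set_mem] := Lv; rewrite /finite_norm => fv.
apply/andP; split; apply/mem_set => //; rewrite /finite_norm.
apply: le_lt_trans fv.
rewrite unlock gt0_ler_poweR//.
- by rewrite in_itv/= leey integral_ge0.
- by rewrite in_itv/= leey integral_ge0.
have mpow (w : T -> R) : measurable_fun setT w ->
    measurable_fun setT (fun x => (`|w x| `^ 2)%:E).
  move=> mw; apply/measurable_EFinP.
  apply: (@measurableT_comp _ _ _ _ _ _ (fun x : R => x `^ 2)%R) => //.
  exact: measurableT_comp.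
apply: ge0_le_integral => //=; [exact: mpow|exact: mpow|].
move=> x _; rewrite lee_fin ge0_ler_powR ?nnegrE//.
by rewrite patchE; case: ifP => // _; rewrite normr0.
Qed.

Lemma norm2_ge0 F : 0 <= norm2 F.
Proof. by rewrite fine_ge0// Lnorm_ge0. Qed.

Lemma norm2_triangle F G : F \in Lfun mu 2%:E -> G \in Lfun mu 2%:E ->
  norm2 (F \+ G) <= norm2 F + norm2 G.
Proof.
move=> LF LG.
exact: (@ler_LnormD _ _ _ mu _ (lee1n 2)
  (Lfun_Sub (lee1n 2) LF) (Lfun_Sub (lee1n 2) LG)).
Qed.

Lemma norm2N F : norm2 (fun x => - F x) = norm2 F.
Proof.
have -> : EFin \o (fun x => - F x) = (\- (EFin \o F))%E by [].
by rewrite oppe_Lnorm.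
Qed.

Lemma norm2Z (c : R) F : F \in Lfun mu 2%:E -> norm2 (c \*: F) = `|c| * norm2 F.
Proof.
move=> LF; have := @LnormZ _ _ _ mu _ (lee1n 2) (Lfun_Sub (lee1n 2) LF) c.
by move=> /= ->; rewrite fineM// fin_real// (lt_le_trans _ (Lnorm_ge0 _ _ _))//=;
  move: LF => /andP[_ /set_mem].
Qed.

Lemma norm2_dist F G : F \in Lfun mu 2%:E -> G \in Lfun mu 2%:E ->
  `|norm2 F - norm2 G| <= norm2 (F \- G).
Proof.
move=> LF LG; rewrite ler_norml lerNl opprB !lerBlDr; apply/andP; split.
  have := norm2_triangle _ _ LF (Lfun2B _ _ LG LF).
  rewrite [X in norm2 X <= _ + _ -> _](_ : _ = G).
    rewrite -(norm2N (G \- F)) addrC.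
    by rewrite (_ : (fun x => - _) = F \- G)//; apply/funext => x /=; rewrite opprB.
  by apply/funext => x /=; rewrite subrKC.
have := norm2_triangle _ _ (Lfun2B _ _ LF LG) LG.
rewrite [X in norm2 X <= _ + _ -> _](_ : _ = F)//.
by apply/funext => x /=; rewrite subrK.
Qed.

Lemma sqr_norm2 F : norm2 F ^+ 2 = \int[mu]_x F x ^+ 2.
Proof.
rewrite -powR_mulrn ?norm2_ge0// -fine_poweR; congr fine.
rewrite powR_Lnorm ?pnatr_eq0//; apply: eq_integral => x _ /=.
by rewrite powR_mulrn// real_normK// num_real.
Qed.

Lemma ae_eq_norm2 F G : F \in Lfun mu 2%:E -> G \in Lfun mu 2%:E ->
  {ae mu, forall x, F x = G x} -> norm2 F = norm2 G.
Proof.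
move=> LF LG FG; apply/eqP; rewrite -(eqrXn2 (n := 2)) ?norm2_ge0// !sqr_norm2.
apply/eqP; congr fine; apply: ae_eq_integral => //=.
- exact/measurable_EFinP/measurable_funX/Lfun2_measurable.
- exact/measurable_EFinP/measurable_funX/Lfun2_measurable.
- by apply: filterS FG => x /= -> _.
Qed.

(** Square integrability makes the cross term integrable, so that the square
    can be expanded under the integral. *)
Lemma sqr_norm2_line F G (t : R) : F \in Lfun mu 2%:E -> G \in Lfun mu 2%:E ->
  norm2 (F \+ t \*: G) ^+ 2 =
  norm2 F ^+ 2 + 2 * t * (\int[mu]_x (F x * G x)) + t ^+ 2 * norm2 G ^+ 2.
Proof.
move=> LF LG.
have iF := Lfun2_integrable_sqr LF.
have iG := Lfun2_integrable_sqr LG.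
have iFG : mu.-integrable setT (EFin \o (fun x => F x * G x)).
  exact/Lfun1_integrable/Lfun2_mul_Lfun1.
have iZ (c : R) (K : T -> R) : mu.-integrable setT (EFin \o K) ->
    mu.-integrable setT (EFin \o (fun x => c * K x)).
  by move=> iK; exact: (integrableZl measurableT c iK).
rewrite !sqr_norm2 -!RintegralZl// -RintegralD//; [|exact: iZ].
rewrite -RintegralD//; [|exact: (integrableD measurableT iF (iZ _ _ iFG))|exact: iZ].
by apply: eq_Rintegral => x _ /=; rewrite -[_ *: _]/(t * G x); ring.
Qed.

(** Compare [w t] with its tangent [M = w 0 + t G]. The quotient of
    |M|^2 is affine in [t]; the rest is (|w t|^2 - |M|^2) / t, which factors as
    (|w t| - |M|) (|w t| + |M|) / t. Its first factor is at most the
    remainder, which is o(t), and its second one is bounded. *)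
Lemma cvg_sqr_norm2_quotient (w : R -> T -> R) (G : T -> R) :
  w 0 \in Lfun mu 2%:E -> G \in Lfun mu 2%:E ->
  (\forall t \near 0^', w t \in Lfun mu 2%:E) ->
  `|t|^-1 * norm2 (w t \- (w 0 \+ t \*: G)) @[t --> 0^'] --> 0 ->
  t^-1 * (norm2 (w t) ^+ 2 - norm2 (w 0) ^+ 2) @[t --> 0^'] -->
    2 * \int[mu]_x (w 0 x * G x).
Proof.
move=> L0 LG Lw rho0.
set c := \int[mu]_x _; set b := norm2 G; set a := norm2 (w 0).
set rho := fun t => _ in rho0.
(* With r the norm of the remainder, |t| rho t = r, and |w t| + |M| is at most
   2 |M| + r with |M| <= a + |t| b. *)
pose bound t := rho t * (2 * a + 2 * `|t| * b + `|t| * rho t).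
have id0 : t @[t --> (0 : R)^'] --> (0 : R) by apply: cvg_within; exact: cvg_id.
have nid0 : `|t| @[t --> (0 : R)^'] --> (0 : R).
  by rewrite -[X in _ --> X](@normr0 R R); exact: cvg_norm.
have bound0 : bound t @[t --> (0 : R)^'] --> (0 : R).
  rewrite -[X in _ --> X](mul0r (2 * a + 2 * 0 * b + 0 * 0)).
  apply: (cvgM rho0); apply: cvgD; last exact: (cvgM nid0 rho0).
  apply: cvgD; first exact: cvg_cst.
  by apply: cvgM; [apply: cvgM; [exact: cvg_cst|exact: nid0]|exact: cvg_cst].
(* The target 2 c is written as the sum of the limits of 2 c, of t b^2 and of
   the error. *)
rewrite -[X in _ --> X]addr0 -[X in _ --> _ + X](mul0r (b ^+ 2)).
rewrite -[X in _ --> X]addr0.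
pose lin t := 2 * c + t * b ^+ 2.
rewrite (_ : (fun t => _) = (fun t => lin t +
   (t^-1 * (norm2 (w t) ^+ 2 - norm2 (w 0) ^+ 2) - lin t))); last first.
  by apply/funext => t; rewrite subrKC.
apply: cvgD.
  apply: cvgD; first exact: cvg_cst.
  by apply: (cvgM id0); exact: cvg_cst.
apply/cvgr0Pnorm_le => e e0.
near=> t.
have t0 : t != 0 by near: t; exact: nbhs_dnbhs_neq.
have Lt : w t \in Lfun mu 2%:E by near: t.
have be : bound t <= e.
  near: t; exact: (cvgr_le 0).
apply: le_trans be.
have LM := Lfun2D _ _ L0 (Lfun2Z t _ LG).
have nt0 : 0 < `|t| by rewrite normr_gt0.
have rhoE : norm2 (w t \- (w 0 \+ t \*: G)) = `|t| * rho t.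
  by rewrite /rho mulrA divff ?mul1r// gt_eqF.
have dist := norm2_dist _ _ Lt LM; rewrite rhoE in dist.
have Mle := norm2_triangle _ _ L0 (Lfun2Z t _ LG).
rewrite norm2Z// -/a -/b in Mle.
have sqrM := sqr_norm2_line _ _ t L0 LG; rewrite -/a -/b -/c in sqrM.
have M0 := norm2_ge0 (w 0 \+ t \*: G).
have N0 := norm2_ge0 (w t).
move: dist Mle sqrM M0 N0; set M := norm2 (w 0 \+ _); set N := norm2 (w t).
move=> dist Mle sqrM M0 N0.
have -> : t^-1 * (N ^+ 2 - a ^+ 2) - lin t = t^-1 * ((N - M) * (N + M)).
  by rewrite -subr_sqr sqrM /lin; field.
rewrite !normrM normfV (ger0_norm (addr_ge0 N0 M0)) ler_pdivrMl//.
have NM : N + M <= 2 * a + 2 * `|t| * b + `|t| * rho t.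
  by move: dist; rewrite ler_norml => /andP[]; lra.
by rewrite /bound mulrA ler_pM// addr_ge0.
Unshelve. all: by end_near. Qed.

End L2_space.

Section L2_restrict.
Context {R : realType} {n : nat}.
Local Notation mu := (@lebesgue_rV R n).
Implicit Types (D : set 'rV[R]_n) (u v : 'rV[R]_n -> R).

Lemma restrictB D u v : (u \- v) \_ D = u \_ D \- v \_ D.
Proof. by apply/funext => x; rewrite /= !patchE; case: ifP; rewrite ?subrr. Qed.

Lemma restrictD D u v : (u \+ v) \_ D = u \_ D \+ v \_ D.
Proof. by apply/funext => x; rewrite /= !patchE; case: ifP; rewrite ?addr0. Qed.

Lemma restrictZ D (c : R) v : (c \*: v) \_ D = c \*: (v \_ D).
Proof. by apply/funext => x; rewrite /= !patchE; case: ifP; rewrite ?scaler0. Qed.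

Lemma restrict_ae D u v : {ae mu, forall x, D x -> u x = v x} ->
  {ae mu, forall x, (u \_ D) x = (v \_ D) x}.
Proof.
by apply: filterS => x uv; rewrite !patchE; case: ifPn => // /set_mem.
Qed.

End L2_restrict.

(** * The reduced cost *)

Lemma openQ {R : realType} : open (@Q R).
Proof.
rewrite (_ : Q = fst @^-1` [set x : R | 0 < x] `&`
  (fst @^-1` [set x : R | x < 1] `&` snd @^-1` [set x : R | 0 < x])); last first.
  by apply/seteqP; split=> [p []|p [? []]].
apply: openI; [|apply: openI].
- by apply: open_comp => [x _|]; [exact: cvg_fst|exact: open_gt].
- by apply: open_comp => [x _|]; [exact: cvg_fst|exact: open_lt].
- by apply: open_comp => [x _|]; [exact: cvg_snd|exact: open_gt].
Qed.

Section cost.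
Context {R : realType} {n : nat}.
Local Notation mu := (@lebesgue_rV R n).
Context (D : set 'rV[R]_n) (S : R * R -> 'rV[R]_n -> R) (q h : R * R).

(** The derivative is linear only up to null sets, so homogeneity, including
    the value at 0, holds almost everywhere; this is enough for the norm of the
    remainder. The restriction to nonzero [h] is what lets [t h] approach 0
    without reaching it. *)
Lemma L2_differentiable_line : h != 0 ->
  (\forall p \near q, in_L2 D (S p)) -> L2_differentiable D S q ->
  exists2 G : 'rV[R]_n -> R, in_L2 D G &
    `|t|^-1 * L2norm D (S (t *: h + q) \- (S q \+ t \*: G)) @[t --> (0 : R)^'] --> 0.
Proof.
move=> h0 LS [dS [LdS dS_lin dS_rem]].
have LSq := nbhs_singleton LS.
(* From dS (1 * 0 + 0) = 1 * dS 0 + dS 0. *)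
have dS0 : {ae mu, forall x, D x -> dS 0 x = 0}.
  apply: filterS (dS_lin 1 0 0) => x /[apply].
  by rewrite scaler0 addr0 mul1r => /eqP; rewrite eq_sym -subr_eq0 addrK => /eqP.
have dSZ t : {ae mu, forall x, D x -> dS (t *: h) x = t * dS h x}.
  apply: filterS2 (dS_lin t h 0) dS0 => x dSx dS0x Dx.
  by rewrite -[X in dS X]addr0 dSx// dS0x// addr0.
exists (dS h) => //.
have th0 := cvg_scale_dnbhs0 _ _ h0.
(* Dividing by |t| instead of |t h| costs the factor |h|. *)
rewrite -[X in _ --> X](mulr0 `|h|).
have lim0 : `|h| * (`|t *: h|^-1 *
    L2norm D (S (q + t *: h) \- S q \- dS (t *: h))) @[t --> (0 : R)^'] -->
    `|h| * 0.
  by apply: cvgM; [exact: cvg_cst|exact: (cvg_comp _ _ th0 dS_rem)].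
apply: (cvg_trans _ lim0); apply: near_eq_cvg.
near=> t.
have t0 : t != 0 by near: t; exact: nbhs_dnbhs_neq.
rewrite /= mulrA; congr (_ * _).
  by rewrite normrZ invfM mulrCA divff ?normr_eq0// mulr1.
rewrite [t *: h + q]addrC.
have LSt : in_L2 D (S (q + t *: h)).
  rewrite addrC; near: t; apply: cvg_within; exact: cvg_line0 LS.
rewrite /L2norm; apply: ae_eq_norm2.
- by rewrite !restrictB; apply: Lfun2B (LdS _); exact: Lfun2B.
- rewrite restrictB restrictD restrictZ; apply: Lfun2B => //.
  by apply: Lfun2D => //; apply: Lfun2Z; exact: LdS.
apply: restrict_ae; apply: filterS (dSZ t) => x dSx Dx /=.
by rewrite dSx// opprD addrA.
Unshelve. all: by end_near. Qed.

Lemma derivable_cost (u_d : 'rV[R]_n -> R) (Reg : R * R -> R) : h != 0 ->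
  (\forall p \near q, in_L2 D (S p)) -> in_L2 D u_d ->
  L2_differentiable D S q -> derivable Reg q h ->
  derivable (cost D u_d S Reg) q h.
Proof.
move=> h0 LS Lu dS dReg.
have [G LG rem] := L2_differentiable_line h0 LS dS.
have LSq := nbhs_singleton LS.
have -> : cost D u_d S Reg = 2^-1 \*: (fun p => L2norm D (S p \- u_d) ^+ 2) + Reg.
  by [].
apply: derivableD => //; apply: derivableZ.
pose w t := (S (t *: h + q) \- u_d) \_ D.
have w0E : w 0 = (S q \- u_d) \_ D by rewrite /w scale0r add0r.
have := cvg_sqr_norm2_quotient mu w (G \_ D).
have Lw0 : w 0 \in Lfun mu 2%:E by rewrite w0E restrictB; exact: Lfun2B.
move=> /(_ Lw0 LG).
have Lw : \forall t \near 0^', w t \in Lfun mu 2%:E.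
  apply: cvg_within; near=> t; rewrite /w restrictB; apply: Lfun2B => //.
  by near: t; exact: cvg_line0 LS.
move=> /(_ Lw); rewrite w0E => quot.
have remE t : w t \- ((S q \- u_d) \_ D \+ t \*: (G \_ D)) =
    (S (t *: h + q) \- (S q \+ t \*: G)) \_ D.
  rewrite /w -restrictZ -restrictD -restrictB; congr (_ \_ D).
  by apply/funext => x /=; ring.
apply: (cvgP _ (quot _)).
by under eq_fun do rewrite remE.
Unshelve. all: by end_near. Qed.

End cost.

Theorem proposition4p2 (R : realType) (n : nat) (n_ge1 : (1 <= n)%N)
  (Omega : set 'rV[R]_n) (Omega_dom : smooth_bounded_domain Omega)
  (eps : R) (eps_gt0 : 0 < eps) (eps_small : eps < 2^-1)
  (f u_d : 'rV[R]_n -> R)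
  (f_reg : in_Hs Omega (2^-1 - eps) f)
  (u_d_reg : in_Hs Omega (2^-1 - eps) u_d)
  (S : R * R -> 'rV[R]_n -> R)
  (S_sol : forall p, Q p -> unique_weak_solution Omega f p (S p))
  (S_diff : forall p, Q p -> L2_differentiable Omega S p)
  (Reg : R * R -> R) (Reg_adm : admissible_regularization Reg)
  (q : R * R) :
  local_minimizer Q (cost Omega u_d S Reg) q ->
  forall h : R * R, Q h ->
    derivable (cost Omega u_d S Reg) q h /\
    'D_h (cost Omega u_d S Reg) q = 0.
Proof.
move=> [Qq qmin] h [h1_gt0 _ _].
have h0 : h != 0 by apply: contraTneq h1_gt0 => ->; rewrite ltxx.
have nearQ : \forall p \near q, Q p by exact: open_nbhs_nbhs (conj openQ Qq).
have mOmega : measurable Omega by case: Omega_dom => /open_measurable_rV.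
have LS : \forall p \near q, in_L2 Omega (S p).
  apply: filterS nearQ => p /S_sol[[[[LSp _] _] _] _].
  by move: LSp; rewrite /in_L2 patch_setT; exact: Lfun2_restrict.
have dReg : derivable Reg q h.
  case: Reg_adm => _ [_ /(_ h)[dReg _]] _.
  by apply: dReg; rewrite inE.
have dcost : derivable (cost Omega u_d S Reg) q h.
  by apply: derivable_cost => //; [case: u_d_reg|exact: S_diff].
split=> //; apply: derive_local_min0 => //.
by apply: filterS2 nearQ qmin => p Qp; apply.
Qed.
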